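(* Let $X=S_k$ be a star with a branch point of order $k$ and let $f:X\to X$ be a homeomorphism. If every edge of $X$ contains a wandering point of $f$, then $h_{\mathrm{pol}}(C(f))=k$, where $C(f):C(X)\to C(X)$ is the map induced by $f$ on the hyperspace of subcontinua of $X$.
   Context: A dendrite is a nonempty, connected, locally connected, compact metric space containing no simple closed curve. For a point $x$ of a dendrite $D$: $x$ is an end point if $D\setminus\{x\}$ is connected; the order of $x$ is the number of components of $D\setminus\{x\}$; $x$ is a branch point if its order is greater than $2$. A tree is a dendrite with finitely many end points. A $k$-star $S_k$ is a tree with only one branch point, of order $k$ (so $k\ge 3$). An edge is an arc (homeomorphic image of a closed interval) connecting two branch points, two end points, or a branch point and an end point; thus $S_k$ is the union of $k$ edges $I_1,\dots,I_k$, each joining the branch point to an end point. For a compact metric space $(X,d)$, $2^X$ is the set of all nonempty closed subsets of $X$ with the Hausdorff metric, $C(X)\subset 2^X$ is the subspace of all nonempty closed connected subsets, and a continuous $f:X\to X$ induces $C(f):C(X)\to C(X)$, $C(f)(A)=\{f(x):x\in A\}$. A point $x\in X$ is wandering for $f$ if there is a neighbourhood $U\ni x$ in $X$ with $f^n(U)\cap U=\emptyset$ for all $n\ge1$. Polynomial entropy: for a continuous map $g$ of a compact metric space $(Z,\rho)$ put $\rho_n^g(x,y)=\max_{0\le j\le n-1}\rho(g^j(x),g^j(y))$; a finite set $E$ is $(n,\varepsilon)$-separated if $\rho_n^g(x,y)\ge\varepsilon$ for all distinct $x,y\in E$; $\mathrm{sep}(n,\varepsilon)$ is the maximal cardinality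 of an $(n,\varepsilon)$-separated subset of $Z$; and $$h_{\mathrm{pol}}(g)=\lim_{\varepsilon\to0}\limsup_{n\to\infty}\frac{\log\mathrm{sep}(n,\varepsilon)}{\log n}.$$ *)

(* Defs.v *)
From HB Require Import structures.
From mathcomp Require Import all_boot all_order all_algebra finmap.
From mathcomp Require Import all_classical all_reals all_analysis.
Set Implicit Arguments.
Unset Strict Implicit.
Unset Printing Implicit Defensive.
Import Order.TTheory GRing.Theory Num.Theory.
Import numFieldNormedType.Exports.
Local Open Scope classical_set_scope.
Local Open Scope ring_scope.

Section topology.
Implicit Types S T : topologicalType.

Definition homeomorphism S T (f : S -> T) :=
  exists g : T -> S, [/\ continuous f, continuous g, cancel f g & cancel g f].

Lemma homeomorphism_continuous S T (f : S -> T) :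
  homeomorphism f -> continuous f.
Proof. by case=> g []. Qed.

(* Only the values of h on A and of its inverse on B = h(A) matter. *)
Definition homeomorphism_between S T (A : set S) (B : set T) (h : S -> T) :=
  exists g : T -> S, [/\ {within A, continuous h}, {within B, continuous g},
    h @` A = B & {in A, cancel h g}].

Definition locally_connected T :=
  forall (x : T) (U : set T), nbhs x U ->
    exists V : set T, [/\ open V, V x, connected V & V `<=` U].

Definition unit_circle (R : realType) : set (R * R) :=
  [set p | p.1 ^+ 2 + p.2 ^+ 2 = 1].

Definition simple_closed_curve (R : realType) T (C : set T) :=
  exists h : R * R -> T, homeomorphism_between (@unit_circle R) C h.

Definition arc_between (R : realType) T (I : set T) (p q : T) :=
  exists h : R -> T, [/\ homeomorphism_between (`[0, 1] : set R) I h, h 0 = p & h 1 = q].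

Definition wandering T (f : T -> T) (x : T) :=
  exists2 U : set T, nbhs x U &
    forall n : nat, (0 < n)%N -> (iter n f @` U) `&` U = set0.

End topology.

Section dendrites.
Context {R : realType}.
Implicit Types X : metricType R.

Definition dendrite X :=
  [/\ [set: X] !=set0, connected [set: X], locally_connected X,
      compact [set: X] & ~ exists C : set X, simple_closed_curve R C].

Definition end_point X (x : X) := connected (~` [set x]).

Definition components_off X (x : X) : set (set X) :=
  connected_component (~` [set x]) @` (~` [set x]).

Definition has_order X (x : X) (k : nat) := (components_off x #= `I_k)%card.

(* The order of x, possibly infinite, is greater than 2. *)
Definition branch_point X (x : X) : Prop := ~~ (components_off x #<= `I_2)%card.

Definition tree X := dendrite X /\ finite_set (@end_point X).

Definition star X (k : nat) :=
  tree X /\ exists b : X, @branch_point X = [set b] /\ has_order b k.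

Lemma star_compact X k : star X k -> compact [set: X].
Proof. by case=> -[[]]. Qed.

(* No condition on the interior of I: in a star, an arc joining two end points
   through the branch point is also an edge. It contains two edges from the
   branch point to an end point, so that asking every edge to contain a point
   of a given kind amounts to asking it of the latter edges. *)
Definition edge X (I : set X) :=
  exists p q : X, [/\ branch_point p \/ end_point p,
    branch_point q \/ end_point q & arc_between R I p q].

End dendrites.

Section hausdorff_distance.
Context {R : realType} {X : metricType R}.
Implicit Types (x y : X) (A B C : set X).

Definition dist_set x A : R := inf [set mdist x a | a in A].

Definition excess A B : R := sup [set dist_set a B | a in A].

Definition hausdorff_dist A B : R := Num.max (excess A B) (excess B A).

Lemma dist_set_le x a A : A a -> dist_set x A <= mdist x a.
Proof.
move=> Aa; apply: ge_inf; last by exists a.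
by exists 0 => _ [b _ <-]; exact: mdist_ge0.
Qed.

Lemma le_dist_set x A (r : R) : A !=set0 ->
  (forall a, A a -> r <= mdist x a) -> r <= dist_set x A.
Proof.
move=> [a Aa] rA; apply: lb_le_inf; first by exists (mdist x a), a.
by move=> _ [b Ab <-]; exact: rA.
Qed.

Lemma dist_set_ge0 x A : A !=set0 -> 0 <= dist_set x A.
Proof. by move=> A0; apply: le_dist_set => // a _; exact: mdist_ge0. Qed.

Lemma dist_setD x y A : A !=set0 -> dist_set x A <= mdist x y + dist_set y A.
Proof.
move=> A0; rewrite -lerBlDl; apply: le_dist_set => // a Aa.
by rewrite lerBlDl (le_trans (dist_set_le x Aa))// metric_triangle.
Qed.

Lemma compact_mdist_bounded : compact [set: X] ->
  exists M : R, forall x y, mdist x y <= M.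
Proof.
move=> cX; have [[x0 _]|X0] := pselect ([set: X] !=set0); last first.
  by exists 0 => x; exfalso; apply: X0; exists x.
suff [M M_ub] : exists M : R, forall x, mdist x0 x <= M.
  exists (M + M) => x y; rewrite (le_trans (metric_triangle x x0 y))//.
  by rewrite lerD// metric_sym.
have /compact_near_coveringP cov := cX.
have : \forall M \near +oo, [set: X] `<=` (fun x => mdist x0 x <= M).
  apply: cov => x _; exists (ball x 1, [set M | mdist x0 x + 1 <= M]).
    by split; [exact: nbhsx_ballx | apply: nbhs_pinfty_ge; exact: num_real].
  move=> [y M]/= [xy]; apply: le_trans.
  rewrite (le_trans (metric_triangle x0 x y))// lerD2l.
  by move: xy; rewrite ballEmdist/= => /ltW.
by move=> /filter_ex[M M_ub]; exists M => x; exact: M_ub.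
Qed.

End hausdorff_distance.

Section hausdorff_metric.
Context {R : realType} {X : metricType R} (cX : compact [set: X]).
Implicit Types (x y : X) (A B C : set X).

Lemma excess_ub A B x : B !=set0 -> A x -> dist_set x B <= excess A B.
Proof.
move=> [b Bb] Ax; apply: ub_le_sup; last by exists x.
have [M M_ub] := compact_mdist_bounded cX; exists M => _ [a Aa <-].
exact: le_trans (dist_set_le a Bb) (M_ub _ _).
Qed.

Lemma ge_excess A B (r : R) : A !=set0 ->
  (forall a, A a -> dist_set a B <= r) -> excess A B <= r.
Proof.
move=> [a Aa] rA; apply: ge_sup; first by exists (dist_set a B), a.
by move=> _ [b Ab <-]; exact: rA.
Qed.

Lemma excess_triangle A B C : A !=set0 -> B !=set0 -> C !=set0 ->
  excess A C <= excess A B + excess B C.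
Proof.
move=> A0 B0 C0; apply: ge_excess => // a Aa.
rewrite -lerBlDr; apply: le_trans (excess_ub B0 Aa).
apply: le_dist_set => // b Bb; rewrite lerBlDr.
by apply: le_trans (dist_setD a b C0) _; rewrite lerD2l; exact: excess_ub.
Qed.

Lemma excess_le0 A B : closed B -> B !=set0 -> excess A B <= 0 -> A `<=` B.
Proof.
move=> cB B0 AB0 a Aa; apply: cB => U /nbhs_ballP[e /= e0 eU].
have aB : dist_set a B < e.
  by apply: le_lt_trans e0; apply: le_trans AB0; exact: excess_ub.
have /(inf_lt _)[|_ [b Bb <-] ab] := aB.
  by case: B0 => b Bb; exists (mdist a b), b.
by exists b; split=> //; apply: eU; rewrite ballEmdist.
Qed.

Lemma excess_refl A : A !=set0 -> excess A A <= 0.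
Proof.
move=> A0; apply: ge_excess => // a Aa.
by rewrite (le_trans (dist_set_le a Aa))// mdistxx.
Qed.

Lemma excess_ge0 A B : A !=set0 -> B !=set0 -> 0 <= excess A B.
Proof.
move=> [a Aa] B0; apply: le_trans (excess_ub B0 Aa).
exact: dist_set_ge0.
Qed.

Lemma hausdorff_distxx A : A !=set0 -> hausdorff_dist A A = 0.
Proof.
move=> A0; rewrite /hausdorff_dist maxxx; apply/eqP.
by rewrite eq_le excess_refl// excess_ge0.
Qed.

Lemma hausdorff_dist_positivity A B : closed A -> closed B ->
  A !=set0 -> B !=set0 -> hausdorff_dist A B = 0 -> A = B.
Proof.
move=> cA cB A0 B0 AB0; apply/seteqP; split; apply: excess_le0 => //;
  by rewrite -AB0 /hausdorff_dist le_max lexx ?orbT.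
Qed.

Lemma hausdorff_dist_sym A B : hausdorff_dist A B = hausdorff_dist B A.
Proof. by rewrite /hausdorff_dist maxC. Qed.

Lemma hausdorff_dist_triangle B A C : A !=set0 -> B !=set0 -> C !=set0 ->
  hausdorff_dist A C <= hausdorff_dist A B + hausdorff_dist B C.
Proof.
move=> A0 B0 C0; rewrite {1}/hausdorff_dist ge_max; apply/andP; split.
  apply: le_trans (excess_triangle A0 B0 C0) _.
  by rewrite lerD// /hausdorff_dist le_max lexx.
apply: le_trans (excess_triangle C0 B0 A0) _; rewrite addrC.
by rewrite lerD// /hausdorff_dist le_max lexx orbT.
Qed.

End hausdorff_metric.

(* Compactness makes the suprema in hausdorff_dist finite, so it is part of
   the type: the metric structure below depends on it. *)
Definition subcontinua (R : realType) (X : metricType R)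
    (cX : compact [set: X]) : Type :=
  {A : set X | [/\ A !=set0, closed A & connected A]}.

Section hyperspace.
Context {R : realType} {X : metricType R} (cX : compact [set: X]).

HB.instance Definition _ := gen_eqMixin (subcontinua cX).
HB.instance Definition _ := gen_choiceMixin (subcontinua cX).

Implicit Types A B C : subcontinua cX.

Let dist A B : R := hausdorff_dist (sval A) (sval B).

Let distxx A : dist A A = 0.
Proof. by case: A => A [A0 cA kA]; exact: hausdorff_distxx. Qed.

Let dist_positivity A B : dist A B = 0 -> A = B.
Proof.
case: A B => [A [A0 cA kA]] [B [B0 cB kB]] /= AB; apply: eq_exist => /=.
exact: (hausdorff_dist_positivity cX).
Qed.

Let dist_sym A B : dist A B = dist B A.
Proof. exact: hausdorff_dist_sym. Qed.

Let dist_triangle B A C : dist A C <= dist A B + dist B C.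
Proof.
by case: A B C => [A []] ? ? ? [B []] ? ? ? [C []] ? ? ?;
  exact: hausdorff_dist_triangle.
Qed.

HB.instance Definition _ := isMetric.Build R (subcontinua cX)
  distxx dist_positivity dist_sym dist_triangle.

Lemma mdist_subcontinuaE A B : mdist A B = hausdorff_dist (sval A) (sval B).
Proof. by []. Qed.

Lemma image_subcontinuum (f : X -> X) (A : set X) : continuous f ->
  [/\ A !=set0, closed A & connected A] ->
  [/\ f @` A !=set0, closed (f @` A) & connected (f @` A)].
Proof.
move=> cf [[a Aa] cA kA]; have cfA := continuous_subspaceT (A := A) cf.
split; first by exists (f a), a.
  apply: compact_closed; first exact: metric_hausdorff.
  apply: continuous_compact => //; exact: subclosed_compact cX _.
exact: connected_continuous_connected.
Qed.

Definition induced_map (f : X -> X) (cf : continuous f) :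
    subcontinua cX -> subcontinua cX :=
  fun A => exist _ (f @` sval A) (image_subcontinuum cf (svalP A)).

End hyperspace.

Arguments induced_map {R X} cX {f} cf.

Section polynomial_entropy.
Context {R : realType} {Z : metricType R}.
Implicit Type g : Z -> Z.

Definition iter_dist g (n : nat) (x y : Z) : R :=
  \big[Num.max/0]_(j < n) mdist (iter j g x) (iter j g y).

Definition separated_set g (n : nat) (e : R) (E : {fset Z}) :=
  forall x y, x \in E -> y \in E -> x != y -> e <= iter_dist g n x y.

Local Open Scope ereal_scope.

Definition sep g (n : nat) (e : R) : \bar R :=
  ereal_sup [set (#|` E|%:R)%:E | E in separated_set g n e].

(* The values for n = 0 and n = 1, where ln n = 0, do not affect limn_esup. *)
Definition pol_entropy g : \bar R :=
  lim ((fun e : R =>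
    limn_esup (fun n => lne (sep g n e) / (ln n%:R)%:E)) @ 0^'+).

End polynomial_entropy.

(* Main.v *)
Require Import Defs.
From HB Require Import structures.
From mathcomp Require Import all_boot all_order all_algebra finmap.
From mathcomp Require Import fingroup perm.
From mathcomp Require Import all_classical all_reals all_analysis.
Import Order.TTheory GRing.Theory Num.Theory.
Import numFieldNormedType.Exports.
Local Open Scope classical_set_scope.
Local Open Scope ring_scope.
Set Implicit Arguments.
Unset Strict Implicit.
Unset Printing Implicit Defensive.

(** Root the star at its branch point b, and let x <<= y mean that the component
    of b in the complement of x does not contain y: either y = x, or x cuts y
    off from b. In a locally connected continuum this cut order is a tree
    order, and every point lies below a maximal one, which is a non-cut point,
    that is, an end point. Two facts turn the star into k chains. Only b has
    order greater than 2, so that beyond a point other than b there is at most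
    one component. There are finitely many end points, so that an open connected
    set contains a continuum through all those that lie in it; its points
    outside this continuum, and so those near its boundary, cannot start a side
    branch (near_above, near_below). Hence lying below a given maximal point is
    an open condition, and connectedness spreads it over a component of the
    complement of b (component_below): each component is a chain with one end
    point e i, and the sets of points below the e i are the edges.

    The hypothesis on f speaks of arcs, so each chain has to be shown to be an
    arc: a strictly monotone continuous function on it (exists_height) maps it
    homeomorphically onto an interval.

    A homeomorphism fixes b and preserves the cut order, so the dynamics is that
    of k increasing maps permuted among the edges.

    Lower bound (sep_ge_expn). A power F = f^m fixes all end points, and the
    wandering point x i of the i-th edge is moved by F. Moving x i back a i times
    by F on every edge, with 0 <= a i < N, gives a subcontinuum: the star with
    tips F^(- a i) (x i). Two of these N^k stars differ in the tip on some edge,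
    and at a time at most m (N - 1) one of the two has the tip x i there while
    the other stops no later than at the neighbour of x i towards b in its
    F-orbit, hence misses a fixed neighbourhood of x i.

    Upper bound (sep_le_expn). A finite set P cuts the edges into pieces
    of small diameter, and the n |P| points of its first n preimages cut
    them into pieces that stay small during n steps. A subcontinuum
    containing b is given by its k tips, and any other one by the two ends of a
    subarc of an edge. Recording between which of the n |P| points these lie
    leaves O(n^k) + O(n^2) = O(n^k) possibilities, as k >= 3, and subcontinua
    with the same record stay close during n steps.

    So the number of separated points lies between two multiples of n^k,
    for all small scales at once. *)

(** * Connected sets and compact chains *)

Section connectedness.
Context {T : topologicalType}.
Implicit Types A B C U V : set T.

Lemma connected_clopen A B : connected A -> A `&` B !=set0 ->
  (exists2 C, open C & A `&` B = A `&` C) ->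
  (exists2 C, closed C & A `&` B = A `&` C) -> A `<=` B.
Proof.
by move=> kA AB0 oAB cAB; rewrite -(kA _ AB0 oAB cAB); exact: subIsetr.
Qed.

(** A property whose truth does not change locally is both open and closed. *)
Lemma connected_locally A B : connected A -> A `&` B !=set0 ->
  (forall z, A z -> exists2 V, nbhs z V &
    forall x y, A x -> A y -> V x -> V y -> B x -> B y) ->
  A `<=` B.
Proof.
move=> kA AB0 AB; apply: connected_clopen => //.
- exists [set z | A z -> B z]°; first exact: open_interior.
  apply/seteqP; split => z [Az]; last first.
    by move=> /nbhs_singleton/(_ Az).
  move=> Bz; split => //; have [V zV VB] := AB z Az.
  have Vz := nbhs_singleton zV.
  by apply: filterS zV => w Vw Aw; exact: (VB z).
- exists (closure (A `&` B)); first exact: closed_closure.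
  apply/seteqP; split => z [Az]; first by move=> Bz; split => //; exact: subset_closure.
  move=> cz; split => //; have [V zV VB] := AB z Az.
  have [x [[Ax Bx] Vx]] := cz V zV.
  by apply: (VB x) => //; exact: nbhs_singleton.
Qed.

Lemma connected_wedge A B x : closed A -> closed B -> connected (A `|` B) ->
  A `&` B = [set x] -> connected A.
Proof.
move=> cA cB kAB ABx E E0 [C oC EAC] [D cD EAD].
have [Ax Bx] : A x /\ B x by have : (A `&` B) x by rewrite ABx.
have ABeq y : A y -> B y -> y = x.
  by move=> Ay By; have : (A `&` B) y by []; rewrite ABx.
(* A clopen part of A that misses the wedge point x stays clopen in the union;
   of a clopen part and its complement in A, one misses x. *)
have key F C' D' : F !=set0 -> ~ F x -> open C' -> closed D' ->
    F = A `&` C' -> F = A `&` D' -> False.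
  move=> F0 nFx oC' cD' FC FD; apply: (nFx).
  have FA : F `<=` A by rewrite FC.
  have nFB y : F y -> ~ B y.
    move=> Fy By; apply: nFx; rewrite -(ABeq y) //; exact: FA.
  suff -> : F = A `|` B by left.
  apply: kAB => //.
  - exists (C' `&` ~` B); first by apply: openI => //; exact: closed_openC.
    apply/seteqP; split => y.
      move=> Fy; split; first by left; exact: FA.
      by split; [move: Fy; rewrite FC => -[]|exact: nFB].
    by move=> [[Ay|By] [Cy nBy]]; [rewrite FC|].
  - exists F; last first.
      by apply/seteqP; split => [y Fy|y [_ //]]; split => //; left; exact: FA.
    by rewrite FD; exact: closedI.
have [Ex|nEx] := pselect (E x); last by case: (key E C D).
apply/seteqP; split; first by rewrite EAC; exact: subIsetl.
move=> y Ay; apply: contrapT => nEy.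
apply: (key (A `\` E) (~` D) (~` C)).
- by exists y.
- by move=> [].
- exact: closed_openC.
- exact: open_closedC.
- by rewrite {1}EAD setDE setCI setIUr setICr set0U.
- by rewrite {1}EAC setDE setCI setIUr setICr set0U.
Qed.

Lemma component_open U x : locally_connected T -> open U ->
  open (connected_component U x).
Proof.
move=> lcT oU; rewrite openE => y Uxy.
have [V [oV Vy kV VU]] := lcT y U
  (open_nbhs_nbhs (conj oU (connected_component_sub Uxy))).
apply: (@filterS _ (nbhs y) _ V) => [z Vz|]; last exact: open_nbhs_nbhs.
by apply: connected_component_trans Uxy _; exists V.
Qed.

(** The sections of the chain above its elements have the finite intersection
    property, and any point adherent to all of them is a bound. It lies in the
    closure of the chain, so that a closed chain has an extremum; reversing the
    relation gives minima. *)
Lemma closed_chain_bound (le : T -> T -> Prop) A : compact [set: T] ->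
  (forall x, le x x) -> (forall x y z, le x y -> le y z -> le x z) ->
  (forall x, closed [set y | le x y]) ->
  A !=set0 -> total_on A le ->
  exists2 t, closure A t & forall s, A s -> le s t.
Proof.
move=> cT le_refl le_trans le_closed A0 Atot.
pose F : set_system T := filter_from A (fun x => A `&` [set y | le x y]).
have FF : ProperFilter F.
  apply: filter_from_proper => [|x Ax]; last by exists x; split => //=.
  apply: filter_from_filter => // x y Ax Ay.
  have [xy|yx] := Atot x y Ax Ay.
    by exists y => // z [Az yz]; split; split => //=; exact: le_trans yz.
  by exists x => // z [Az xz]; split; split => //=; exact: le_trans xz.
have [t [_ Ft]] := cT F FF (@filterT _ _ _).
exists t => [V Vt|s As].
  have [x Ax] := A0.
  have [|y [[Ay _] Vy]] := Ft (A `&` [set y | le x y]) V _ Vt; last by exists y.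
  by exists x.
apply: (le_closed s) => V Vt.
have [|y [[_ sy] Vy]] := Ft (A `&` [set y | le s y]) V _ Vt; last by exists y.
by exists s.
Qed.

End connectedness.

Section continuum_join.
Context {R : realType} {X : metricType R} (lcX : locally_connected X).
Implicit Types (x y : X) (A C U V : set X).

Lemma small_connected_nbhs x U : nbhs x U -> exists V,
  [/\ open V, V x, connected V, closure V `<=` U & V `<=` U].
Proof.
move=> xU; have /nbhs_ballP[e /= e0 eU] := xU.
have [V [oV Vx kV Ve]] := lcX (nbhsx_ballx x (e / 2) (divr_gt0 e0 (ltr0n R 2))).
exists V; split => // y.
  move=> /(_ (ball y (e / 2)) (nbhsx_ballx y _ (divr_gt0 e0 (ltr0n R 2)))).
  case=> z [/Ve xz yz]; apply: eU.
  by rewrite (splitr e); apply: ball_triangle xz (ball_sym yz).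
by move=> /Ve xy; apply/eU/(le_ball _ xy); rewrite ler_pdivrMr// ler_peMr ?ler1n ?ltW.
Qed.

(** An open connected set need not contain the closure of the connected sets
    that fill it; joining its points by closed subsets keeps a positive distance
    from any given point outside. *)
Lemma continuum_join U x y : open U -> connected U -> U x -> U y ->
  exists C, [/\ closed C, connected C, C `<=` U, C x & C y].
Proof.
move=> oU kU Ux.
pose J z := exists C, [/\ closed C, connected C, C `<=` U, C x & C z].
move: y; apply: (@connected_locally _ U [set z | J z]) => //.
  exists x; split => //; exists [set x]; split => //.
  - apply: compact_closed; first exact: metric_hausdorff.
    exact: compact_set1.
  - exact: connected1.
  - by move=> _ ->.
move=> z Uz.
have [V [oV Vz kV cVU VU]] := small_connected_nbhs (open_nbhs_nbhs (conj oU Uz)).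
exists V; first exact: open_nbhs_nbhs.
move=> v w _ _ Vv Vw [C [cC kC CU Cx Cv]]; exists (C `|` closure V); split.
- by apply: closedU => //; exact: closed_closure.
- apply: connectedU => //; last exact: connected_closure.
  by exists v; split => //; exact: subset_closure.
- by rewrite subUset.
- by left.
- by right; apply: subset_closure.
Qed.

Lemma continuum_hull U x (F : set X) : finite_set F -> open U -> connected U ->
  U x -> exists C, [/\ closed C, connected C, C `<=` U, C x & U `&` F `<=` C].
Proof.
move=> /finite_seqP[s ->] oU kU Ux; elim: s => [|a s [C [cC kC CU Cx sC]]].
  exists [set x]; split => //; last by move=> y [].
  - apply: compact_closed; first exact: metric_hausdorff.
    exact: compact_set1.
  - exact: connected1.
  - by move=> _ ->.
have [Ua|nUa] := pselect (U a); last first.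
  exists C; split => // y [Uy /=]; rewrite inE => /orP[/eqP ya|ys].
    by rewrite ya in Uy.
  exact: sC.
have [D [cD kD DU Dx Da]] := continuum_join oU kU Ux Ua.
exists (C `|` D); split; [exact: closedU| |by rewrite subUset|by left|].
  by apply: connectedU => //; exists x.
move=> y [Uy /=]; rewrite inE => /orP[/eqP ->|ys]; first by right.
by left; apply: sC.
Qed.

End continuum_join.

(** * The cut order of a rooted continuum *)

Definition root_side (T : topologicalType) (b x : T) : set T :=
  connected_component (~` [set x]) b.

Definition cut_le (T : topologicalType) (b x y : T) : Prop := ~ root_side b x y.

Section cut_order.
Context {R : realType} {X : metricType R} (cX : compact [set: X])
  (kX : connected [set: X]) (lcX : locally_connected X) (b : X).
Implicit Types (x y z : X) (A C U V : set X).

Local Notation "x '<<=' y" := (cut_le b x y) (at level 70).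

Lemma open_compl1 x : open (~` [set x]).
Proof.
apply: closed_openC; apply: compact_closed; first exact: metric_hausdorff.
exact: compact_set1.
Qed.

Lemma component_compl1_open x y : open (connected_component (~` [set x]) y).
Proof. by apply: component_open => //; exact: open_compl1. Qed.

Lemma root_side_open x : open (root_side b x).
Proof. exact: component_compl1_open. Qed.

Lemma root_side_connected x : connected (root_side b x).
Proof. exact: component_connected. Qed.

Lemma root_side_root x : x <> b -> root_side b x b.
Proof. by move=> xb; apply: connected_component_refl => /esym. Qed.

Lemma cut_le_refl x : x <<= x.
Proof. by move=> /connected_component_sub; exact. Qed.

Lemma cut_le_root y : b <<= y.
Proof. by rewrite /cut_le /root_side connected_component_out//; exact. Qed.

Lemma cut_le_root_eq y : y <<= b -> y = b.
Proof. by move=> yb; apply: contrapT => /root_side_root. Qed.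

Lemma root_sideS x y : x <<= y -> root_side b x `<=` root_side b y.
Proof.
move=> xy; have [->|xb] := pselect (x = b).
  by rewrite /root_side connected_component_out//; exact.
apply: connected_component_max; first exact: root_side_root.
- by move=> z xz zy; apply: xy; rewrite -zy.
- exact: root_side_connected.
Qed.

Lemma cut_le_trans x y z : x <<= y -> y <<= z -> x <<= z.
Proof. by move=> /root_sideS xy yz /xy. Qed.

Lemma closure_componentI U y :
  open U -> closure (connected_component U y) `&` U `<=` connected_component U y.
Proof.
move=> oU z [cz Uz].
have [V [oV Vz kV VU]] := lcX (open_nbhs_nbhs (conj oU Uz)).
have [w [yw Vw]] := cz V (open_nbhs_nbhs (conj oV Vz)).
by apply: connected_component_trans yw _; exists V.
Qed.

(** Since the whole space is connected, the component is not closed, and the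
    point that was removed is the only one that can be missing from it. *)
Lemma closure_component_compl1 x y : y <> x ->
  closure (connected_component (~` [set x]) y)
    = connected_component (~` [set x]) y `|` [set x].
Proof.
move=> yx; set C := connected_component _ _.
have CsubCx : closure C `<=` C `|` [set x].
  move=> z cz; have [->|zx] := pselect (z = x); first by right.
  by left; apply: closure_componentI; [exact: open_compl1|split].
apply/seteqP; split => // z [|->]; first exact: subset_closure.
apply: contrapT => ncx; have cC : closed C.
  by move=> w cw; have [//|wx] := CsubCx _ cw; rewrite wx in cw.
have Cy : C y by apply: connected_component_refl.
have : C x.
  apply: (@connected_clopen _ [set: X]) => //; first by exists y.
  - by exists C => //; exact: component_compl1_open.
  - by exists C.
by move=> /connected_component_sub; exact.
Qed.

Lemma closure_root_side x : x <> b -> closure (root_side b x) x.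
Proof.
by move=> xb; rewrite /root_side closure_component_compl1; [right|move=> /esym].
Qed.

(** If x and y precede each other, then they have the same component of b in
    their complements, and each of them is the only point of its boundary. *)
Lemma cut_le_anti x y : x <<= y -> y <<= x -> x = y.
Proof.
move=> xy yx; have [xb|/closure_root_side cx] := pselect (x = b).
  by rewrite xb in yx *; rewrite (cut_le_root_eq yx).
apply: contrapT => nxy; apply: yx.
apply: closure_componentI; first exact: open_compl1.
by split => //; apply: closureS cx; exact: root_sideS.
Qed.

Lemma component_above x y : x <<= y -> y <> x ->
  connected_component (~` [set x]) y `<=` [set z | x <<= z].
Proof.
move=> xy yx z yz xz; apply: xy; apply: connected_component_trans xz _.
exact: connected_component_sym.
Qed.

Lemma above_connected x : connected [set y | x <<= y].
Proof.
pose D y := connected_component (~` [set x]) y `|` [set x].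
have -> : [set y | x <<= y] = \bigcup_(y in [set y | x <<= y]) D y.
  apply/seteqP; split=> y /=.
    move=> xy; exists y => //; have [->|yx] := pselect (y = x); first by right.
    by left; exact: connected_component_refl.
  move=> [z xz [|->]]; last exact: cut_le_refl.
  have [->|zx] := pselect (z = x); last exact: component_above.
  by rewrite connected_component_out//; exact.
apply: bigcup_connected; first by exists x => y _; right.
move=> y _; rewrite /D; have [->|yx] := pselect (y = x).
  by rewrite connected_component_out ?set0U; [exact: connected1|exact].
rewrite -closure_component_compl1//; apply: connected_closure.
exact: component_connected.
Qed.

(** If x and y were incomparable, then the points beyond y, which form a connected
    set that avoids x, would all be on the same side of x as b. *)
Lemma cut_le_comparable x y z : x <<= z -> y <<= z -> x <<= y \/ y <<= x.
Proof.
move=> xz yz; apply: contrapT => /not_orP[/contrapT xy /contrapT yx].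
apply: xz; rewrite /root_side (same_connected_component xy).
exists [set w | y <<= w] => //; split; [exact: cut_le_refl| |exact: above_connected].
by move=> w /= yw wx; rewrite wx in yw.
Qed.

Lemma mem_between A x y z : connected A -> A x -> A y -> ~ z <<= x -> z <<= y ->
  A z.
Proof.
move=> kA Ax Ay /contrapT zx zy; apply: contrapT => nAz; apply: zy.
apply: connected_component_trans zx _; exists A => //; split => //.
by move=> w Aw wz; rewrite wz in Aw.
Qed.

Lemma above_closed x : closed [set y | x <<= y].
Proof. by apply: open_closedC; exact: root_side_open. Qed.

Lemma strictly_above_open x : open [set y | x <<= y /\ y <> x].
Proof.
rewrite openE => y [xy yx].
apply: (@filterS _ (nbhs y) _ (connected_component (~` [set x]) y)).
  move=> z yz; split; first exact: component_above yz.
  by have := connected_component_sub yz.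
apply: open_nbhs_nbhs; split; first exact: component_compl1_open.
exact: connected_component_refl.
Qed.

(** When x does not precede y, a continuum joins b to y without x, and no point
    outside this continuum precedes y either. *)
Lemma below_closed y : closed [set x | x <<= y].
Proof.
rewrite -[X in closed X]setCK; apply: open_closedC; rewrite openE => x /contrapT xy.
have xb : x <> b by move=> xb; move: xy; rewrite xb; exact: cut_le_root.
have [C [cC kC Cx Cb Cy]] := continuum_join lcX (@root_side_open x)
  (@root_side_connected x) (root_side_root xb) xy.
apply: (@filterS _ (nbhs x) _ (~` C)).
  move=> w nCw; apply; exists C => //; split => //.
  by move=> z Cz zw; rewrite zw in Cz.
apply: open_nbhs_nbhs; split; first exact: closed_openC.
by move=> /Cx; exact: cut_le_refl.
Qed.

Lemma cut_le_chain_bound A : A !=set0 -> total_on A (cut_le b) ->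
  exists2 t, closure A t & forall x, A x -> x <<= t.
Proof.
apply: closed_chain_bound => //; [exact: cut_le_refl|exact: cut_le_trans|].
exact: above_closed.
Qed.

Definition cut_maximal e := forall y, e <<= y -> y = e.

(** Zorn's lemma, with compactness to bound the chains; together with the next
    lemma, this is the existence of non-cut points beyond any given point. *)
Lemma below_cut_maximal x : exists2 e, x <<= e & cut_maximal e.
Proof.
pose T := {y | x <<= y}.
have [||||[e xe] emax] :=
    @Zorn T (fun s t => `[< sval s <<= sval t >]).
- by move=> t; apply/asboolP; exact: cut_le_refl.
- move=> r s t /asboolP rs /asboolP st; apply/asboolP; exact: cut_le_trans st.
- move=> [s sx] [t tx] /asboolP /= st /asboolP /= ts; apply: eq_exist => /=.
  exact: cut_le_anti.
- move=> A Atot; have [A0|A0] := pselect (A !=set0); last first.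
    by exists (exist _ x (@cut_le_refl x)) => s As; exfalso; apply: A0; exists s.
  have [||t _ tA] := @cut_le_chain_bound (sval @` A).
  + by case: A0 => s As; exists (sval s), s.
  + move=> _ _ [s As <-] [t At <-].
    by have [/asboolP|/asboolP] := Atot _ _ As At; [left|right].
  + have xt : x <<= t.
      case: A0 => s As; apply: cut_le_trans (svalP s) _.
      by apply: tA; exists s.
    exists (exist _ t xt) => s As; apply/asboolP => /=.
    by apply: tA; exists s.
- exists e => // y ey.
  by have [] := emax (exist _ y (cut_le_trans xe ey)) (asboolT ey).
Qed.

Lemma cut_maximal_end_point e : cut_maximal e -> end_point e.
Proof.
move=> emax; rewrite /end_point (_ : ~` [set e] = root_side b e).
  exact: root_side_connected.
apply/seteqP; split => y; last exact: connected_component_sub.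
by move=> ye; apply: contrapT => /emax.
Qed.

End cut_order.

(** * Branches of a star are chains *)

Section star_order.
Context {R : realType} {X : metricType R} (cX : compact [set: X])
  (kX : connected [set: X]) (lcX : locally_connected X) (b : X)
  (finE : finite_set (@end_point R X))
  (branchE : @branch_point R X = [set b]).
Implicit Types (x y z : X) (A C U V : set X).

Local Notation "x '<<=' y" := (cut_le b x y) (at level 70).

(** The components of b, y and z in the complement of x cannot be three different
    ones, and that of b is different from the other two. *)
Lemma nonbranch_component x y z : x <> b -> x <<= y -> y <> x ->
  x <<= z -> z <> x -> connected_component (~` [set x]) y z.
Proof.
move=> xb xy yx xz zx.
have : ~ branch_point x by rewrite branchE.
move=> /negP; rewrite negbK => /pcard_leP[f].
pose c w := connected_component (~` [set x]) w.
have cc w : w <> x -> components_off x (c w) by move=> wx; exists w.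
have sep v w : v <> x -> w <> x -> f (c v) = f (c w) -> c v w.
  move=> vx wx fvw; have -> : c v = c w.
    by apply: (@inj _ _ _ f) => //; rewrite inE; exact: cc.
  exact: connected_component_refl.
have lt2 w : w <> x -> (f (c w) < 2)%N.
  by move=> wx; have /= := @funS _ _ _ _ f _ (cc w wx).
have bx : b <> x by move=> /esym.
have nby : f (c b) <> f (c y) by move=> /(sep _ _ bx yx).
have nbz : f (c b) <> f (c z) by move=> /(sep _ _ bx zx).
apply: sep => //; move: (lt2 b bx) (lt2 y yx) (lt2 z zx) nby nbz.
by move: (f (c b)) (f (c y)) (f (c z)) => [|[|?]] [|[|?]] [|[|?]].
Qed.

(** A continuum C in the component V of e in the complement of z contains all end
    points that lie in V. A point p of V outside C precedes some end point, which
    is in V; if p did not precede e, then p would separate two points of C. *)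
Lemma near_above z e : cut_maximal b e -> z <<= e -> e <> z ->
  \forall p \near z, connected_component (~` [set z]) e p -> p <<= e.
Proof.
move=> emax ze ez; set V := connected_component _ _.
(* C stays away from z, so that p avoids C as soon as p is close to z. *)
have [|||C [cC kC CV Ce EC]] := @continuum_hull _ _ lcX V e _ finE.
- exact: component_compl1_open.
- exact: component_connected.
- exact: connected_component_refl.
apply: (@filterS _ (nbhs z) _ (~` C)); last first.
  apply: open_nbhs_nbhs; split; first exact: closed_openC.
  by move=> /CV/connected_component_sub; exact.
move=> p nCp Vp; apply: contrapT => npe; apply: nCp.
have [e' pe' e'max] := below_cut_maximal cX kX lcX b p.
have Ve' : V e'.
  apply: (connected_component_trans Vp).
  exists [set y | p <<= y] => //; split.
  - exact: cut_le_refl.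
  - move=> w /= pw wz; rewrite wz in pw.
    have zp : z <<= p by apply: (component_above ze ez Vp).
    have pz := cut_le_anti kX lcX pw zp; rewrite pz in Vp.
    by have := connected_component_sub Vp; exact.
  - exact: above_connected.
apply: (mem_between kC Ce _ npe pe'); apply: EC; split => //.
exact: cut_maximal_end_point e'max.
Qed.

(** The same continuum, in the component of b in the complement of z, contains b:
    a point p outside it precedes an end point that is beyond z, as p would
    otherwise separate it from b inside the continuum. So p and z have a common
    upper bound and are comparable. *)
Lemma near_below z : z <> b ->
  \forall p \near z, root_side b z p -> p <<= z.
Proof.
move=> zb.
have [|||C [cC kC CV Cb EC]] := @continuum_hull _ _ lcX (root_side b z) b _ finE.
- exact: root_side_open.
- exact: root_side_connected.
- exact: root_side_root.
apply: (@filterS _ (nbhs z) _ (~` C)); last first.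
  apply: open_nbhs_nbhs; split; first exact: closed_openC.
  by move=> /CV; exact: cut_le_refl.
move=> p nCp zp; apply: contrapT => npz; apply: nCp.
have [e' pe' e'max] := below_cut_maximal cX kX lcX b p.
have pb : ~ p <<= b.
  by move=> /cut_le_root_eq pb; apply: npz; rewrite pb; exact: cut_le_root.
apply: (mem_between kC Cb _ pb pe'); apply: EC; split.
  apply: contrapT => ze'.
  by have [//|] := cut_le_comparable kX lcX pe' ze'; exact.
exact: cut_maximal_end_point e'max.
Qed.

(** Lying below e is a closed condition, and an open one by the two
    preceding lemmas, so it holds on the whole component. *)
Lemma component_below e y : e <> b -> cut_maximal b e ->
  connected_component (~` [set b]) e y -> y <<= e.
Proof.
move=> eb emax; move: y; set C := connected_component _ _.
have oC : open C by exact: component_compl1_open.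
apply: (@connected_clopen _ C [set y | y <<= e]).
- exact: component_connected.
- exists e; split; last exact: cut_le_refl.
  exact: connected_component_refl.
- exists (C `&` [set y | y <<= e]); last by rewrite setIA setIid.
  rewrite openE => z [Cz ze].
  have zb : z <> b by have := connected_component_sub Cz.
  have Cnear : nbhs z C by exact: open_nbhs_nbhs.
  have [ez|ez] := pselect (e = z).
    apply: filterS2 Cnear (near_below zb) => p Cp pz; split => //=.
    have [|/contrapT/pz] := pselect (z <<= p); last by rewrite ez.
    by rewrite -ez => /emax ->; exact: cut_le_refl.
  apply: filterS3 Cnear (near_below zb) (near_above emax ze ez) => p Cp pz pe.
  split => //=; have [zp|/contrapT/pz pz'] := pselect (z <<= p); last first.
    exact: cut_le_trans ze.
  have [->//|pz'] := pselect (p = z).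
  by apply: pe; exact: nonbranch_component.
- by exists [set y | y <<= e] => //; exact: below_closed.
Qed.

Lemma above_component x y : x <> b -> x <<= y ->
  connected_component (~` [set b]) x y.
Proof.
move=> xb xy; exists [set z | x <<= z] => //.
split; [exact: cut_le_refl| |exact: above_connected].
by move=> z /= xz zb; rewrite zb in xz; apply/xb/cut_le_root_eq.
Qed.

(** The points below x and those between x and e form a wedge, whose union is the
    closure of a component of the complement of b. *)
Lemma below_connected x : connected [set y | y <<= x].
Proof.
have [e xe emax] := below_cut_maximal cX kX lcX b x.
have [eb|eb] := pselect (e = b).
  rewrite (_ : [set y | _] = [set b]); first exact: connected1.
  rewrite eb in xe; rewrite (cut_le_root_eq xe).
  apply/seteqP; split => y; first exact: cut_le_root_eq.
  by move=> ->; exact: cut_le_refl.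
apply: (@connected_wedge _ _ [set y | x <<= y /\ y <<= e] x).
- exact: below_closed.
- by apply: closedI; [exact: above_closed|exact: below_closed].
- rewrite (_ : _ `|` _ = closure (connected_component (~` [set b]) e)).
    by apply: connected_closure; exact: component_connected.
  rewrite closure_component_compl1//; apply/seteqP; split=> y.
    have [->|yb] := pselect (y = b); first by right.
    move=> yx; left; apply/connected_component_sym/above_component => //.
    by case: yx => [yx|[]//]; exact: cut_le_trans xe.
  move=> ye; have {}ye : y <<= e.
    by case: ye => [|->]; [exact: component_below|exact: cut_le_root].
  by have [|xy] := cut_le_comparable kX lcX ye xe; [left|right].
- apply/seteqP; split => y; first by move=> [yx [xy _]]; exact: (cut_le_anti kX lcX yx xy).
  by move=> ->; split; [|split] => //=; exact: cut_le_refl.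
Qed.

Lemma exists_branch_ends k : (0 < k)%N -> has_order b k ->
  exists e : 'I_k -> X, [/\ forall i, e i <> b, forall i, cut_maximal b (e i),
    forall x, exists i, x <<= e i &
    forall i j x, x <<= e i -> x <<= e j -> x <> b -> i = j].
Proof.
rewrite /has_order => k0 /card_esym/card_set_bijP[F [Ffun Finj Fsurj]].
have exE (i : 'I_k) : exists e, [/\ e <> b, cut_maximal b e &
    F i = connected_component (~` [set b]) e].
  have [x /= xb <-] := Ffun i (ltn_ord i).
  have [e xe emax] := below_cut_maximal cX kX lcX b x.
  exists e; split => //; first by move=> eb; rewrite eb in xe; apply/xb/cut_le_root_eq.
  by apply: same_connected_component; exact: above_component.
have [e eP] := choice exE; exists e; split.
- by move=> i; have [] := eP i.
- by move=> i; have [] := eP i.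
- move=> x; have [->|xb] := pselect (x = b).
    by exists (Ordinal k0); exact: cut_le_root.
  have [|i /= ik Fi] := Fsurj (connected_component (~` [set b]) x).
    by exists x.
  exists (Ordinal ik); have [eb emax Fe] := eP (Ordinal ik).
  apply: component_below => //; rewrite -Fe/= Fi.
  exact: connected_component_refl.
- move=> i j x xi xj xb; apply: val_inj; apply: Finj.
  + by rewrite inE/=.
  + by rewrite inE/=.
  + have [_ _ ->] := eP i; have [_ _ ->] := eP j.
    rewrite -(same_connected_component (above_component xb xi)).
    by rewrite -(same_connected_component (above_component xb xj)).
Qed.

End star_order.

(** * Edges are arcs *)

Section height.
Context {R : realType} {X : metricType R} (cX : compact [set: X])
  (kX : connected [set: X]) (lcX : locally_connected X) (b : X).
Implicit Types (x y z p e : X) (A C U V : set X).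

Local Notation "x '<<=' y" := (cut_le b x y) (at level 70).

(** The points x for which the statement holds below x in place of e form a set
    that connectedness propagates: a small connected set contains the order
    interval between any two of its points, so that to pass from x to y in
    such a set it is enough to add the point x to P. *)
Lemma below_partition e (d : R) : connected [set y | y <<= e] -> 0 < d ->
  exists P : seq X, (forall p, p \in P -> p <<= e) /\
    forall u v, u <<= v -> v <<= e -> (forall p, p \in P -> u <<= p -> v <<= p) ->
      mdist u v < d.
Proof.
move=> kK d0.
pose S := [set x | exists P : seq X, (forall p, p \in P -> p <<= e) /\
  forall u v, u <<= v -> v <<= x -> (forall p, p \in P -> u <<= p -> v <<= p) ->
    mdist u v < d].
suff : [set y | y <<= e] `<=` S by apply; exact: cut_le_refl.
apply: connected_locally => //.
  exists b; split; first exact: cut_le_root.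
  exists [::]; split => // u v uv vb _.
  rewrite (cut_le_root_eq vb) (cut_le_root_eq (cut_le_trans uv vb)).
  by rewrite mdistxx.
move=> z ze; have d20 : 0 < d / 2 by rewrite divr_gt0.
have [V [oV Vz kV Vd]] := lcX (nbhsx_ballx z _ d20).
exists V; first exact: open_nbhs_nbhs.
move=> x y xe ye Vx Vy [P [Pe Pd]]; exists (x :: P); split.
  by move=> p; rewrite inE => /orP[/eqP->//|]; exact: Pe.
move=> u v uv vy uvP; have [vx|nvx] := pselect (v <<= x).
  by apply: Pd => // p pP; apply: uvP; rewrite inE pP orbT.
have nux : ~ u <<= x by move=> ux; apply/nvx/uvP => //; rewrite mem_head.
have Vu : V u by apply: (mem_between kV Vx Vy nux); exact: cut_le_trans vy.
have Vv : V v by exact: (mem_between kV Vx Vy nvx).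
have := ball_triangle (ball_sym (Vd _ Vu)) (Vd _ Vv).
by rewrite -splitr ballEmdist.
Qed.

(** The distance to the part of the space that is not beyond p vanishes up to p
    and is positive beyond; taking the running maximum makes it monotone. *)
Definition rise p x : R :=
  sup [set dist_set y (~` [set z | p <<= z /\ z <> p]) | y in [set y | y <<= x]].

Let beyond p := [set z | p <<= z /\ z <> p].

Let beyondC_neq0 p : ~` beyond p !=set0.
Proof. by exists p => -[]. Qed.

Let rise_has_sup p x :
  has_sup [set dist_set y (~` beyond p) | y in [set y | y <<= x]].
Proof.
have [M M_ub] := compact_mdist_bounded cX; split.
  by exists (dist_set x (~` beyond p)), x => //; exact: cut_le_refl.
exists M => _ [y _ <-]; apply: le_trans (M_ub y p).
by apply: dist_set_le => -[].
Qed.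

Lemma rise_ge p x y : y <<= x -> dist_set y (~` beyond p) <= rise p x.
Proof.
by move=> yx; apply: ub_le_sup; [have [] := rise_has_sup p x|exists y].
Qed.

Lemma rise_le p x (r : R) :
  (forall y, y <<= x -> dist_set y (~` beyond p) <= r) -> rise p x <= r.
Proof.
move=> xr; apply: ge_sup; first by have [] := rise_has_sup p x.
by move=> _ [y yx <-]; exact: xr.
Qed.

Lemma rise_homo p x y : x <<= y -> rise p x <= rise p y.
Proof.
by move=> xy; apply: rise_le => z zx; apply: rise_ge; exact: cut_le_trans xy.
Qed.

Lemma rise_ge0 p x : 0 <= rise p x.
Proof.
apply: le_trans (rise_ge p (@cut_le_refl _ _ b x)).
exact: dist_set_ge0.
Qed.

Lemma rise_eq0 p x : x <<= p -> rise p x = 0.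
Proof.
move=> xp; apply/eqP; rewrite eq_le rise_ge0 andbT; apply: rise_le => y yx.
rewrite -(mdistxx y); apply: dist_set_le => -[py]; apply.
by apply: (cut_le_anti kX lcX) py; exact: cut_le_trans xp.
Qed.

Lemma dist_setC_gt0 A x : open A -> A x -> ~` A !=set0 -> 0 < dist_set x (~` A).
Proof.
move=> oA Ax A0; have /nbhs_ballP[r /= r0 rA] := open_nbhs_nbhs (conj oA Ax).
apply: lt_le_trans (r0) _; apply: le_dist_set => // y nAy.
by rewrite leNgt; apply/negP => xy; apply/nAy/rA; rewrite ballEmdist.
Qed.

Lemma rise_gt0 p x : p <<= x -> x <> p -> 0 < rise p x.
Proof.
move=> px xp; apply: lt_le_trans (rise_ge p (@cut_le_refl _ _ b x)).
by apply: dist_setC_gt0 => //; exact: strictly_above_open.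
Qed.

(** Going from y up to x inside V, a new maximum can only be reached at a point of
    V, and the distance to a set is 1-Lipschitz. *)
Lemma rise_oscillation p V (d : R) x y : connected V ->
  (forall u v, V u -> V v -> mdist u v <= d) -> V x -> V y ->
  x <<= y \/ y <<= x -> rise p x <= rise p y + d.
Proof.
move=> kV Vd Vx Vy xy; have d0 : 0 <= d by rewrite -(mdistxx x); exact: Vd.
case: xy => [xy|yx].
  by rewrite -[leLHS]addr0; apply: lerD => //; exact: rise_homo.
apply: rise_le => w wx; have [wy|nwy] := pselect (w <<= y).
  by rewrite -[leLHS]addr0; apply: lerD => //; exact: rise_ge.
have Vw : V w by exact: (mem_between kV Vy Vx nwy).
apply: le_trans (dist_setD w y (beyondC_neq0 p)) _; rewrite addrC.
by apply: lerD; [apply: rise_ge; exact: cut_le_refl|exact: Vd].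
Qed.

(** The weighted sum of the functions rise p over the points p of countably many
    ever finer finite partitions of the chain: any two points of the chain are
    separated by one of these p. The bound on the oscillation, which is a form of
    continuity, passes from the summands to the sum because the weights sum
    to 1. *)
Lemma exists_height e : connected [set y | y <<= e] ->
  exists h : X -> R,
    (forall x y, x <<= y -> y <<= e -> x <> y -> h x < h y) /\
    (forall V (d : R) x y, connected V ->
      (forall u v, V u -> V v -> mdist u v <= d) -> V x -> V y ->
      x <<= e -> y <<= e -> h x <= h y + d).
Proof.
move=> kK; have [P PP] := choice (fun n : nat =>
  @below_partition e n.+1%:R^-1 kK ltac:(by [])).
(* The countably many partition points in one sequence. *)
pose q (m : nat) := if (choice.unpickle m : option (nat * nat)) is Some ni
  then nth b (P ni.1) ni.2 else b.
have [M M_ub] := compact_mdist_bounded cX.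
have M0 : 0 <= M by rewrite -(mdistxx b).
have riseM p x : rise p x <= M.
  apply: rise_le => y _; apply: le_trans (M_ub y p).
  by apply: dist_set_le => -[].
pose w (r : R) (m : nat) : R := r / (2 ^ (m + 1))%:R.
have w_ge0 r m : 0 <= r -> 0 <= w r m by move=> r0; rewrite divr_ge0.
have w_le r s m : r <= s -> w r m <= w s m.
  by move=> rs; rewrite ler_pM2r// invr_gt0 ltr0n expn_gt0.
have cw r : series (w r) @ \oo --> r.
  have := @cvg_geometric_series_half R r 0.
  by rewrite expr0 divr1.
pose a x m := w (rise (q m) x) m.
have ca x : cvgn (series (a x)).
  apply: (@series_le_cvg _ _ (w M)); last exact: (cvgP _ (cw M)).
  - by move=> m; apply: w_ge0; exact: rise_ge0.
  - by move=> m; exact: w_ge0.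
  - by move=> m; apply: w_le; exact: riseM.
exists (fun x => limn (series (a x))); split; last first.
  move=> V d x y kV Vd Vx Vy xe ye.
  rewrite -(cvg_lim _ (cw d))// -lim_seriesD//; last exact: (cvgP _ (cw d)).
  apply: lim_series_le => //.
    by apply: is_cvg_seriesD => //; exact: (cvgP _ (cw d)).
  move=> m; rewrite /a /w/= -[leRHS]mulrDl ler_pM2r ?invr_gt0 ?ltr0n ?expn_gt0//.
  apply: rise_oscillation kV Vd Vx Vy _.
  exact: (cut_le_comparable kX lcX xe ye).
move=> x y xy ye nxy.
have [n nxy'] : exists n : nat, n.+1%:R^-1 < mdist x y.
  have : 0 < mdist x y by rewrite mdist_gt0; exact/eqP.
  move=> /ltr_add_invr[n]; rewrite add0r; by exists n.
have [p [pP xp nyp]] : exists p, [/\ p \in P n, x <<= p & ~ y <<= p].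
  apply: contrapT => np; have [_ /(_ x y xy ye)] := PP n.
  move=> H; have : mdist x y < n.+1%:R^-1.
    by apply: H => p pP xp; apply: contrapT => yp; apply: np; exists p.
  by move=> /(lt_trans nxy'); rewrite ltxx.
have [m qm] : exists m, q m = p.
  exists (choice.pickle (n, index p (P n))); rewrite /q choice.pickleK /=.
  by rewrite nth_index.
have py : p <<= y.
  by have [//|] := cut_le_comparable kX lcX ((PP n).1 p pP) ye.
have yp : y <> p by move=> yp; apply: nyp; rewrite yp; exact: cut_le_refl.
rewrite -subr_gt0 -lim_seriesB//.
apply: (@lt_le_trans _ _ (a y m - a x m)).
  rewrite subr_gt0 /a /w qm ltr_pM2r ?invr_gt0 ?ltr0n ?expn_gt0//.
  by rewrite (rise_eq0 xp) rise_gt0.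
have ge0 j : 0 <= (a y - a x) j by rewrite subr_ge0; apply: w_le; exact: rise_homo.
apply: (@le_trans _ _ (series (a y - a x) m.+1)); last first.
  apply: nondecreasing_cvgn_le; last exact: is_cvg_seriesB.
  by apply: nondecreasing_series => j _ _; exact: ge0.
rewrite /series /= big_nat_recr//= lerDr; apply: sumr_ge0 => j _; exact: ge0.
Qed.

End height.

Section arcs.
Context {R : realType} {X : metricType R}.
Implicit Types (x y z p q : X) (K : set X).

(** The image of K under h is the interval from h p to h q, since K is connected.
    The inverse of the rescaled h is continuous: the image of a closed part of K
    is compact, hence closed. *)
Lemma arc_of_injection K (h : X -> R) p q : compact K -> connected K ->
  {within K, continuous h} -> {in K &, injective h} -> K p -> K q -> p <> q ->
  (forall x, K x -> h p <= h x <= h q) -> arc_between R K p q.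
Proof.
move=> cK kK ch hinj Kp Kq pq hpq; pose L := h q - h p.
have L0 : 0 < L.
  rewrite subr_gt0 lt_neqAle; have /andP[_ ->] := hpq p Kp; rewrite andbT.
  by apply/eqP => /hinj; rewrite !inE => /(_ Kp Kq).
pose g x := (h x - h p) / L.
have cg : {within K, continuous g}.
  move=> x; apply: cvgM; last exact: cvg_cst.
  by apply: cvgB; [exact: ch|exact: cvg_cst].
have ginj x y : K x -> K y -> g x = g y -> x = y.
  move=> Kx Ky /(congr1 (fun t => t * L + h p)).
  rewrite /g !mulfVK ?gt_eqF// !subrK => /hinj; apply; exact/mem_set.
have g01 x : K x -> (`[0, 1]%classic : set R) (g x).
  move=> Kx; have /andP[px xq] := hpq x Kx.
  rewrite /= in_itv/= /g ler_pdivrMr// mul1r lerD2r xq andbT.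
  by apply: divr_ge0; [rewrite subr_ge0|exact: ltW].
have gp : g p = 0 by rewrite /g subrr mul0r.
have gq : g q = 1 by rewrite /g divff// gt_eqF.
have gsurj t : (`[0, 1]%classic : set R) t -> exists2 x, K x & g x = t.
  rewrite /= in_itv/= => t01.
  have /connected_intervalP := connected_continuous_connected kK cg.
  move=> /(_ 0 1 _ _ t t01)[||y Ky <-]; last by exists y.
  - by exists p.
  - by exists q.
pose s t := xget p [set x | K x /\ g x = t].
have sK t : (`[0, 1]%classic : set R) t -> K (s t) /\ g (s t) = t.
  move=> t01; have [x Kx gx] := gsurj t t01.
  rewrite /s; case: xgetP => [y _ //|/(_ x) nx].
  by exfalso; apply: nx.
have gK x : K x -> s (g x) = x.
  by move=> Kx; have [Ks /ginj] := sK _ (g01 x Kx); apply.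
exists s; split; last 2 first.
- by rewrite -gp gK.
- by rewrite -gq gK.
exists g; split => //=; last first.
- by move=> t; rewrite inE => /sK[].
- apply/seteqP; split => [_ [t /sK[Ks _] <-]//|x Kx].
  by exists (g x); [exact: g01|exact: gK].
apply/subspace_continuousP => t t01.
have [Kst gst] := sK t t01.
move=> W /= sW; have [N [oN Nst NW]]: exists N, [/\ open N, N (s t) & N `<=` W].
  by move: sW; rewrite nbhsE => -[N [oN Ns] NW]; exists N.
have cKN : compact (K `&` ~` N).
  apply: (subclosed_compact _ cK); last exact: subIsetl.
    apply: closedI; last exact: open_closedC.
    by apply: compact_closed cK; exact: metric_hausdorff.
pose F := g @` (K `&` ~` N).
have cF : closed F.
  apply: compact_closed; first exact: Rhausdorff.
  apply: continuous_compact cKN.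
  exact: continuous_subspaceW cg.
have nFt : ~ F t.
  move=> [x [Kx nNx] gx]; apply: nNx.
  by rewrite (_ : x = s t)//; apply: ginj => //; rewrite gx.
apply: (@filterS _ (nbhs t) _ (~` F)); last first.
  by apply: open_nbhs_nbhs; split => //; exact: closed_openC.
move=> r nFr r01; apply: NW; apply: contrapT => nN.
by have [Ksr gsr] := sK r r01; apply: nFr; exists (s r).
Qed.

End arcs.

Section below_arc.
Context {R : realType} {X : metricType R} (cX : compact [set: X])
  (kX : connected [set: X]) (lcX : locally_connected X) (b : X).
Implicit Types (x y z e : X).

Local Notation "x '<<=' y" := (cut_le b x y) (at level 70).

Lemma below_arc e : e <> b -> connected [set y | y <<= e] ->
  arc_between R [set y | y <<= e] b e.
Proof.
move=> eb kK; have [h [hlt hosc]] := exists_height cX kX lcX kK.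
have hle x y : x <<= y -> y <<= e -> h x <= h y.
  by move=> xy ye; have [->//|nxy] := pselect (x = y); exact/ltW/hlt.
apply: (arc_of_injection (h := h)) => //.
- by apply: subclosed_compact cX _ => //; exact: below_closed.
- apply/subspace_continuousP => z ze; apply/cvgrPdist_le => d d0.
  have d20 : 0 < d / 2 by rewrite divr_gt0.
  have [V [oV Vz kV Vd]] := lcX (nbhsx_ballx z _ d20).
  have Vdiam u v : V u -> V v -> mdist u v <= d.
    move=> Vu Vv; have := ball_triangle (ball_sym (Vd _ Vu)) (Vd _ Vv).
    by rewrite -splitr ballEmdist; exact: ltW.
  apply: (@filterS _ (nbhs z) _ V); last exact: open_nbhs_nbhs.
  move=> x Vx xe; rewrite ler_distl lerBlDr.
  by rewrite !(hosc _ _ _ _ kV Vdiam).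
- move=> x y; rewrite !inE => xe ye hxy; apply: contrapT => nxy.
  have [xy|yx] := cut_le_comparable kX lcX xe ye.
    by have := hlt x y xy ye nxy; rewrite hxy ltxx.
  by have := hlt y x yx xe (nesym nxy); rewrite hxy ltxx.
- exact: cut_le_root.
- exact: cut_le_refl.
- exact: nesym.
- by move=> x xe; rewrite !hle//; [exact: cut_le_refl|exact: cut_le_root].
Qed.

End below_arc.

(** * Homeomorphisms and the cut order *)

Section homeomorphism_order.
Context {R : realType} {X : metricType R}.
Implicit Types (x y z b : X) (f g : X -> X).

Lemma component_image f x y z : continuous f -> injective f ->
  connected_component (~` [set x]) y z ->
  connected_component (~` [set f x]) (f y) (f z).
Proof.
move=> cf finj [C [Cy Cx kC] Cz]; exists (f @` C); last by exists z.
split; first by exists y.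
- by move=> _ [w Cw <-] /finj; exact: Cx.
- apply: connected_continuous_connected => //; exact: continuous_subspaceT.
Qed.

Lemma branch_point_homeomorphism f x : homeomorphism f ->
  branch_point x -> branch_point (f x).
Proof.
move=> [g [cf cg fK gK]]; rewrite /branch_point; apply/contra.
apply: card_le_trans; apply: card_le_trans (card_image_le (fun A => g @` A) _).
apply: subset_card_le => _ [y yx <-].
exists (connected_component (~` [set f x]) (f y)).
  by exists (f y) => // /(can_inj fK).
apply/seteqP; split => z.
  move=> [w + <-] => /(component_image cg (can_inj gK)).
  by rewrite !fK.
by move=> yz; exists (f z) => //; apply: component_image yz => //; exact: can_inj fK.
Qed.

Lemma cut_le_homeomorphism f b x y : homeomorphism f -> f b = b ->
  cut_le b x y <-> cut_le b (f x) (f y).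
Proof.
move=> [g [cf cg fK gK]] fb; split => xy; apply: contra_not xy.
  have gb : g b = b by rewrite -{1}fb fK.
  rewrite /root_side => /(component_image cg (can_inj gK)).
  by rewrite !fK gb.
rewrite /root_side => /(component_image cf (can_inj fK)).
by rewrite fb.
Qed.

Lemma homeomorphism_inverse f : homeomorphism f ->
  exists2 g, homeomorphism g & cancel f g /\ cancel g f.
Proof. by move=> [g [cf cg fK gK]]; exists g => //; exists f. Qed.

Lemma homeomorphism_iter f n : homeomorphism f -> homeomorphism (iter n f).
Proof.
move=> [g [cf cg fK gK]]; exists (iter n g).
elim: n => [|n [cfn cgn fKn gKn]].
  by split => // x; exact: cvg_id.
split => [x|x|x|x].
- by apply: (@continuous_comp _ _ _ (iter n f) f); [exact: cfn|exact: cf].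
- by apply: (@continuous_comp _ _ _ (iter n g) g); [exact: cgn|exact: cg].
- by rewrite [iter n.+1 f x]iterS [iter n.+1 g _]iterSr fK fKn.
- by rewrite [iter n.+1 g x]iterS [iter n.+1 f _]iterSr gK gKn.
Qed.

Lemma iter_cancel f g n : cancel f g -> cancel (iter n f) (iter n g).
Proof.
by move=> fK; elim: n => // n IH x; rewrite [iter n.+1 f x]iterS iterSr fK IH.
Qed.

Lemma iter_cancel_sub f g m n x : cancel g f -> (m <= n)%N ->
  iter n f (iter m g x) = iter (n - m) f x.
Proof.
by move=> gK mn; rewrite -{1}(subnK mn) iterD (iter_cancel _ gK).
Qed.

Lemma iter_cancel_subr f g m n x : cancel g f -> (n <= m)%N ->
  iter n f (iter m g x) = iter (m - n) g x.
Proof.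
by move=> gK mn; rewrite -{1}(subnKC mn) iterD (iter_cancel _ gK).
Qed.

Lemma wandering_iter f n x : wandering f x -> (0 < n)%N -> iter n f x <> x.
Proof.
move=> [U xU Uf] n0 fx; have Ux := nbhs_singleton xU.
suff : (iter n f @` U `&` U) x by rewrite Uf.
by split => //; exists x.
Qed.

End homeomorphism_order.

(** * Separated families of stars *)

(** From here on the star is only used through its cut order: e lists the end
    points, and the points below e i form the i-th edge. *)
Section star_dynamics.
Context {R : realType} {X : metricType R} (cX : compact [set: X])
  (kX : connected [set: X]) (lcX : locally_connected X) (b : X).
Context (k : nat) (e : 'I_k -> X) (eb : forall i, e i <> b)
  (emax : forall i, cut_maximal b (e i))
  (ecover : forall x, exists i, cut_le b x (e i))
  (edisj : forall i j x, cut_le b x (e i) -> cut_le b x (e j) -> x <> b -> i = j)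
  (ecomp : forall i y, connected_component (~` [set b]) (e i) y -> cut_le b y (e i))
  (below_kX : forall x, connected [set y | cut_le b y x]).
Context (f : X -> X) (homf : homeomorphism f) (fb : f b = b).
Implicit Types (x y z : X) (A : set X) (i : 'I_k) (j : nat).

Local Notation "x '<<=' y" := (cut_le b x y) (at level 70).
Local Notation Cf := (induced_map cX (homeomorphism_continuous homf)).

Lemma iter_root n : iter n f b = b.
Proof. by elim: n => //= n ->. Qed.

Lemma cut_le_iter n x y : x <<= y <-> iter n f x <<= iter n f y.
Proof.
by apply: cut_le_homeomorphism; [exact: homeomorphism_iter|exact: iter_root].
Qed.

Lemma sval_iter_induced n (A : subcontinua cX) :
  sval (iter n Cf A) = iter n f @` sval A.
Proof.
elim: n => [|n /= ->]; first by rewrite /= image_id.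
exact: image_comp.
Qed.

Lemma iter_below n x : iter n f @` [set y | y <<= x] = [set y | y <<= iter n f x].
Proof.
have [g _ [fK gK]] := homeomorphism_inverse homf.
apply/seteqP; split => [_ [y yx <-]|y yx]; first exact: (cut_le_iter n y x).1.
exists (iter n g y); last exact: iter_cancel.
by apply/(cut_le_iter n); rewrite (iter_cancel _ gK).
Qed.

Lemma end_inj : injective e.
Proof.
move=> i j eij; apply: (@edisj i j (e i)) => //; first exact: cut_le_refl.
by rewrite eij; exact: cut_le_refl.
Qed.

Lemma cut_maximal_end x : x <> b -> cut_maximal b x -> exists i, x = e i.
Proof. by move=> xb xmax; have [i /xmax] := ecover x; exists i. Qed.

Lemma image_end i : exists i', f (e i) = e i'.
Proof.
have [g _ [fK gK]] := homeomorphism_inverse homf.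
apply: cut_maximal_end.
  by move=> feb; apply: (eb (i := i)); apply: (can_inj fK); rewrite feb fb.
move=> y fey; rewrite -(gK y); congr f; apply: (emax (i := i)).
by apply/(cut_le_homeomorphism _ _ homf fb); rewrite gK.
Qed.

(** The end points are permuted, and a permutation has finite order. *)
Lemma exists_period : exists2 m, (0 < m)%N & forall i, iter m f (e i) = e i.
Proof.
have [g _ [fK gK]] := homeomorphism_inverse homf.
have [s fe] := choice image_end.
have sinj : injective s.
  by move=> i j sij; apply/end_inj/(can_inj fK); rewrite !fe sij.
pose p := perm sinj.
have ep n i : iter n f (e i) = e ((p ^+ n)%g i).
  elim: n => [|n IH]; first by rewrite expg0 perm1.
  by rewrite iterS IH fe expgSr permM permE.
exists #[p]%g => [|i]; first exact: order_gt0.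
by rewrite ep expg_order perm1.
Qed.

(** A point of an edge that is moved by an order automorphism F has a neighbour
    towards the branch point in its orbit, its image or its preimage, and the
    half of the orbit that starts there stays below this neighbour. *)
Lemma exists_lower_orbit_point (F G : X -> X) i x :
  (forall u v, u <<= v <-> F u <<= F v) -> cancel F G -> cancel G F ->
  F b = b -> F (e i) = e i -> x <<= e i -> F x <> x ->
  exists y, [/\ y <<= x, y <> x, y <> b &
    (forall l, (0 < l)%N -> iter l F x <<= y) \/
    (forall l, (0 < l)%N -> iter l G x <<= y)].
Proof.
move=> Fle FK GK Fb Fe xe Fx.
have Gle u v : u <<= v <-> G u <<= G v by rewrite [X in _ <-> X]Fle !GK.
have Gb : G b = b by rewrite -{1}Fb FK.
have xb : x <> b by move=> xb; apply: Fx; rewrite xb.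
have down H : (forall u v, u <<= v <-> H u <<= H v) -> H x <<= x ->
    forall l, (0 < l)%N -> iter l H x <<= H x.
  move=> Hle Hx [//|l] _; rewrite iterSr; elim: l => [|l IH]; first exact: cut_le_refl.
  by rewrite iterS -Hle; exact: cut_le_trans IH Hx.
have Fxe : F x <<= e i by rewrite -Fe -Fle.
have [Fxx|xFx] := cut_le_comparable kX lcX Fxe xe.
  exists (F x); split => //; last by left; exact: down.
  by move=> Fxb; apply: xb; rewrite -(FK x) Fxb.
exists (G x); split => //.
- by rewrite Fle GK.
- by move=> Gx; apply: Fx; rewrite -{1}Gx GK.
- by move=> Gxb; apply: xb; rewrite -(GK x) Gxb.
- by right; apply: down => //; rewrite Fle GK.
Qed.

Definition substar (t : 'I_k -> X) : set X := [set z | exists i, z <<= t i].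

Lemma substar_subcontinuum t :
  [/\ substar t !=set0, closed (substar t) & connected (substar t)].
Proof.
have -> : substar t = \bigcup_(i in [set: 'I_k]) [set z | z <<= t i].
  by apply/seteqP; split => [z [i zi]|z [i _ zi]]; exists i.
split.
- by have [i _] := ecover b; exists b, i => //; exact: cut_le_root.
- by apply: closed_bigcup => [|i _]; [exact: finite_finset|exact: below_closed].
- by apply: bigcup_connected => //; exists b => i _; exact: cut_le_root.
Qed.

Lemma iter_substar n t : iter n f @` substar t = substar (fun i => iter n f (t i)).
Proof.
apply/seteqP; split => [_ [z [i zi] <-]|z [i]].
  by exists i; exact: (cut_le_iter n z (t i)).1.
have : [set y | y <<= iter n f (t i)] z -> (iter n f @` [set y | y <<= t i]) z.
  by rewrite iter_below.
by move=> /[apply] -[y yi <-]; exists y => //; exists i.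
Qed.

(** The set B stays outside the open set of points strictly beyond p, so x is at
    least as far from B as from the complement of that open set. *)
Lemma hausdorff_dist_beyond A B x p : A x -> B !=set0 ->
  (forall z, B z -> p <<= z -> z = p) ->
  dist_set x (~` [set z | p <<= z /\ z <> p]) <= hausdorff_dist A B.
Proof.
move=> Ax B0 Bp; rewrite /hausdorff_dist le_max; apply/orP; left.
apply: le_trans (excess_ub cX B0 Ax).
by apply: le_dist_set => // a Ba; apply: dist_set_le => -[/(Bp _ Ba)].
Qed.

Lemma sep_ge_expn : (forall i, exists2 x, x <<= e i & wandering f x) ->
  exists m (d : R), [/\ (0 < m)%N, 0 < d & forall N n r, (m * N <= n)%N -> r <= d ->
    (((N ^ k)%N%:R)%:E <= sep Cf n r)%E].
Proof.
move=> wand; have [g homg [fK gK]] := homeomorphism_inverse homf.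
have [m m0 me] := exists_period.
pose F := iter m f; pose G := iter m g.
have FK : cancel F G by exact: iter_cancel.
have GK : cancel G F by exact: iter_cancel.
have Fb : F b = b by exact: iter_root.
have Fle u v : u <<= v <-> F u <<= F v by exact: cut_le_iter.
have Fe i : F (e i) = e i by exact: me.
have Ge i : G (e i) = e i by rewrite -{1}Fe FK.
have Gle u v : u <<= v <-> G u <<= G v by rewrite [X in _ <-> X]Fle !GK.
have xE i : exists x, x <<= e i /\ F x <> x.
  by have [x xi xw] := wand i; exists x; split => //; exact: wandering_iter.
have [x xP] := choice xE.
have yE i := exists_lower_orbit_point Fle FK GK Fb (Fe i) (xP i).1 (xP i).2.
have [y yP] := choice yE.
pose r i := dist_set (x i) (~` [set z | y i <<= z /\ z <> y i]).
have r0 i : 0 < r i.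
  have [yx nyx _ _] := yP i; apply: dist_setC_gt0.
  - exact: strictly_above_open.
  - by split => //; exact: nesym.
  - by exists (y i) => -[].
pose d := \big[Num.min/1]_(i < k) r i.
exists m, d; split => //; first by apply/lt_bigmin.
move=> N n d' mN d'd.
pose t (a : {ffun 'I_k -> 'I_N}) i := iter (a i) G (x i).
pose Y a : subcontinua cX := exist _ (substar (t a)) (substar_subcontinuum (t a)).
have iterF c z i : z <<= e i -> iter c F z <<= e i.
  by move=> zi; elim: c => //= c IH; rewrite -Fe -Fle.
have ti a i : t a i <<= e i.
  rewrite /t; elim: (nat_of_ord (a i)) => [|c IH]; first by have [] := xP i.
  by rewrite iterS -Ge -Gle.
have far a a' i c : iter c F (t a i) = x i -> iter c F (t a' i) <<= y i ->
    d <= mdist (iter (m * c) Cf (Y a)) (iter (m * c) Cf (Y a')).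
  move=> cx cy; rewrite mdist_subcontinuaE !sval_iter_induced /= !iter_substar.
  apply: (@le_trans _ _ (r i)); first exact: bigmin_le_cond.
  have iterm z : iter (m * c) f z = iter c F z by rewrite mulnC iterM.
  apply: hausdorff_dist_beyond.
  - by exists i; rewrite iterm cx; exact: cut_le_refl.
  - by exists b, i; exact: cut_le_root.
  - move=> z [j]; rewrite iterm => zj yz.
    have [ji|ji] := eqVneq j i.
      by apply: (cut_le_anti kX lcX) yz; rewrite ji in zj; exact: cut_le_trans cy.
    have [yx _ yb _] := yP i; exfalso; move/eqP : ji; apply.
    apply: (@edisj j i (y i)) => //.
      by apply: cut_le_trans yz _; apply: cut_le_trans zj _; exact: iterF.
    by apply: cut_le_trans yx _; have [] := xP i.
have separated a a' : a != a' -> exists2 c, (c < N)%N &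
    d <= mdist (iter (m * c) Cf (Y a)) (iter (m * c) Cf (Y a')).
  move=> aa'; have [i ai] : exists i, a i != a' i.
    apply/existsP; rewrite -negb_forall; apply: contra aa' => /forallP aa'.
    by apply/eqP/ffunP => i; exact/eqP.
  (* If the F-orbit of x i descends, compare the stars at the later of the times
     a i and a' i, when one has the tip x i and the other has moved past it
     towards b; if it ascends, at the earlier one, when the other has yet to
     reach x i. *)
  have hit (a1 : {ffun 'I_k -> 'I_N}) : iter (a1 i) F (t a1 i) = x i.
    by rewrite (iter_cancel _ GK).
  have [_ _ _ [Fy|Gy]] := yP i; wlog lt_aa' : a a' aa' ai / (a i < a' i)%N.
  - move=> H; have [|ge] := ltnP (a i) (a' i); first exact: H.
    have [|||c cN cd] := H a' a; rewrite 1?eq_sym//.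
      by rewrite ltn_neqAle ge andbT eq_sym.
    by exists c => //; rewrite metric_sym.
  - exists (a' i) => //; rewrite metric_sym; apply: (far _ _ i) (hit a') _.
    rewrite (iter_cancel_sub _ GK) 1?ltnW//; apply: Fy.
    by rewrite subn_gt0.
  - move=> H; have [|ge] := ltnP (a i) (a' i); first exact: H.
    have [|||c cN cd] := H a' a; rewrite 1?eq_sym//.
      by rewrite ltn_neqAle ge andbT eq_sym.
    by exists c => //; rewrite metric_sym.
  - exists (a i) => //; apply: (far _ _ i) (hit a) _.
    rewrite (iter_cancel_subr _ GK) 1?ltnW//; apply: Gy.
    by rewrite subn_gt0.
have d0 : 0 < d by apply/lt_bigmin.
have Yinj : injective Y.
  move=> a a' Yaa'; apply/eqP; apply: contrapT => /negP/separated[c _].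
  by rewrite Yaa' mdistxx leNgt d0.
apply: ereal_sup_ubound; exists [fset Y a | a : {ffun 'I_k -> 'I_N}]%fset.
  move=> _ _ /imfsetP[a _ ->] /imfsetP[a' _ ->] YY.
  have [|c cN cd] := separated a a'; first by apply: contra YY => /eqP ->.
  apply: le_trans d'd (le_trans cd _).
  have mc : (m * c < n)%N by apply: leq_trans mN; rewrite ltn_pmul2l.
  exact: (le_bigmax _ (fun j : 'I_n => mdist (iter j Cf (Y a)) (iter j Cf (Y a')))
    (Ordinal mc)).
by rewrite card_imfset//= -cardE card_ffun !card_ord.
Qed.

(** * Coding subcontinua *)

Lemma exists_partition (d : R) : 0 < d -> exists P : seq X,
  forall u v, u <<= v -> (forall p, p \in P -> u <<= p -> v <<= p) -> mdist u v < d.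
Proof.
move=> d0; have [P PP] := choice (fun i => below_partition lcX (below_kX (x := e i)) d0).
exists (flatten [seq P i | i <- enum 'I_k]) => u v uv uvP.
have [i vi] := ecover v; apply: (PP i).2 => // p pP; apply: uvP.
by apply/flatten_mapP; exists i => //; rewrite mem_enum.
Qed.

(** As f preserves the order, an order interval with no point of the first n
    preimages of the partition, except perhaps its upper end, is mapped into a
    single piece at each of the first n times. *)
Lemma exists_iter_partition (d : R) : 0 < d -> exists c : nat, forall n,
  exists2 Q : seq X, size Q = (n * c)%N & forall u v, u <<= v ->
    (forall q, q \in Q -> u <<= q -> v <<= q) ->
    forall j, (j < n)%N -> mdist (iter j f u) (iter j f v) < d.
Proof.
move=> d0; have [P PP] := exists_partition d0; exists (size P) => n.
have [g _ [fK gK]] := homeomorphism_inverse homf.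
exists [seq iter j g p | j <- iota 0 n, p <- P].
  by rewrite size_allpairs size_iota.
move=> u v uv uvQ j jn; apply: PP; first exact: (cut_le_iter j u v).1.
move=> p pP; rewrite -(iter_cancel j gK p) -!cut_le_iter; apply: uvQ.
by apply: allpairs_f => //; rewrite mem_iota.
Qed.

(** Among the points of a chain the rank decreases upwards, and equal ranks mean
    that no point of Q comes between. *)
Definition rank (Q : seq X) u := count (fun q => `[< u <<= q >]) Q.

Lemma eq_rank Q u v : u <<= v -> rank Q u = rank Q v ->
  forall q, q \in Q -> u <<= q -> v <<= q.
Proof.
move=> uv; rewrite /rank; elim: Q => //= a Q IH.
have le : (count (fun q => `[< v <<= q >]) Q <= count (fun q => `[< u <<= q >]) Q)%N.
  by apply: sub_count => q /asboolP vq; apply/asboolP; exact: cut_le_trans vq.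
have lea : (`[< v <<= a >] <= `[< u <<= a >])%N.
  case: (asboolP (v <<= a)) => //= va.
  by rewrite (asboolT (cut_le_trans uv va)).
move=> eqa q; rewrite inE => /orP[/eqP -> ua|qQ]; last first.
  apply: IH qQ; apply/eqP; rewrite eqn_leq le andbT.
  by rewrite -(leq_add2l `[< u <<= a >]) eqa leq_add2r.
apply: contrapT => nva; move: eqa le.
by rewrite (asboolT ua) (asboolF nva) add1n add0n => <-; rewrite ltnn.
Qed.

(** A subcontinuum contains every point that separates two of its points, so it is
    determined by its extremal points on the edges that it meets. *)
Lemma subcontinuum_cases A : [/\ A !=set0, closed A & connected A] ->
  (exists2 t, A = substar t & forall i, t i <<= e i) \/
  (exists i s t, [/\ s <<= t, t <<= e i & A = [set z | s <<= z /\ z <<= t]]).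
Proof.
move=> [A0 cA kA]; have [Ab|nAb] := pselect (A b).
  left; have tE i : exists t, [/\ A t, t <<= e i &
      forall z, A z -> z <<= e i -> z <<= t].
    have cAi : closed (A `&` [set z | z <<= e i]).
      by apply: closedI => //; exact: below_closed.
    have [||t] := @cut_le_chain_bound _ _ cX lcX b (A `&` [set z | z <<= e i]).
    - by exists b; split => //; exact: cut_le_root.
    - by move=> x y [_ xi] [_ yi]; exact: (cut_le_comparable kX lcX xi yi).
    move=> /cAi[At ti] tub; exists t; split => // z Az zi; exact: tub.
  have [t tP] := choice tE; exists t; last by move=> i; have [] := tP i.
  apply/seteqP; split => z.
    move=> Az; have [i zi] := ecover z; exists i.
    by have [_ _] := tP i; apply.
  move=> [i zi]; have [->//|zb] := pselect (z = b).
  have [At _ _] := tP i; apply: (mem_between kA Ab At _ zi).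
  by move=> /cut_le_root_eq.
right; have [a Aa] := A0; have [i ai] := ecover a.
have ab : a <> b by move=> ab; rewrite ab in Aa.
have Ai z : A z -> z <<= e i.
  move=> Az; apply: ecomp; apply: (@connected_component_trans _ _ a).
    by apply: connected_component_sym; exact: above_component.
  by exists A => //; split => // y Ay yb; rewrite yb in Ay.
have Atot : total_on A (cut_le b).
  by move=> x y /Ai xi /Ai yi; exact: (cut_le_comparable kX lcX xi yi).
have [t /cA At tub] := cut_le_chain_bound cX lcX A0 Atot.
have [||||s /cA As slb] := @closed_chain_bound _ (fun x y => y <<= x) A cX _ _ _ A0.
- exact: cut_le_refl.
- by move=> x y z yx zy; exact: cut_le_trans yx.
- by move=> x; exact: below_closed.
- by move=> x y /Atot/[apply] -[]; [right|left].
exists i, s, t; split; [exact: slb|exact: Ai|].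
apply/seteqP; split => z; first by move=> Az; split; [exact: slb|exact: tub].
move=> [sz zt]; have [zs|nzs] := pselect (z <<= s).
  by rewrite (cut_le_anti kX lcX zs sz).
exact: (mem_between kA As At nzs zt).
Qed.

Definition star_code r : finType :=
  ({ffun 'I_k -> 'I_r.+1} + 'I_k * ('I_r.+1 * 'I_r.+1))%type.

(** The first kind of code is meant for subcontinua that contain b, given by the
    ranks of their tips; the second for the other ones, given by an edge and the
    ranks of the two ends. *)
Definition has_code (Q : seq X) (c : star_code (size Q)) A :=
  match c with
  | inl a => exists t, [/\ A = substar t, forall i, t i <<= e i &
      forall i, rank Q (t i) = a i]
  | inr (i, (a, a')) => exists s t, [/\ s <<= t, t <<= e i,
      A = [set z | s <<= z /\ z <<= t], rank Q s = a & rank Q t = a']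
  end.

Lemma exists_code Q A : [/\ A !=set0, closed A & connected A] ->
  exists c : star_code (size Q), has_code c A.
Proof.
have rk u : (rank Q u < (size Q).+1)%N by rewrite ltnS count_size.
move=> /subcontinuum_cases[[t At ti]|[i [s [t [st ti Ast]]]]].
  exists (inl [ffun i => Ordinal (rk (t i))]), t.
  by split => // i; rewrite ffunE.
by exists (inr (i, (Ordinal (rk s), Ordinal (rk t)))), s, t.
Qed.

Section same_code.
Context (Q : seq X) (n : nat) (d : R) (dQ : forall u v, u <<= v ->
  (forall q, q \in Q -> u <<= q -> v <<= q) ->
  forall j, (j < n)%N -> mdist (iter j f u) (iter j f v) < d).

Lemma eq_rank_close u v w w' j : u <<= w -> w <<= w' -> w' <<= v ->
  rank Q u = rank Q v -> (j < n)%N -> mdist (iter j f w) (iter j f w') < d.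
Proof.
move=> uw ww' wv uvQ jn; apply: dQ => // q qQ wq.
have uv : u <<= v := cut_le_trans uw (cut_le_trans ww' wv).
exact/(cut_le_trans wv)/(eq_rank uv uvQ qQ)/(cut_le_trans uw).
Qed.

(** If z is in A' there is nothing to do. Otherwise z lies, on an edge, between an
    extremal point of A and the corresponding one of A', and these have the same
    rank. *)
Lemma eq_code_close (c : star_code (size Q)) A A' j z : has_code c A ->
  has_code c A' -> (j < n)%N -> A z ->
  exists2 z', A' z' & mdist (iter j f z) (iter j f z') < d.
Proof.
move=> cA cA' jn Az; have d0 : 0 < d.
  rewrite -(mdistxx (iter j f z)); apply: dQ => //; exact: cut_le_refl.
have self : A' z -> exists2 z', A' z' & mdist (iter j f z) (iter j f z') < d.
  by move=> A'z; exists z => //; rewrite mdistxx.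
case: c cA cA' => [a|[i [a a']]] /=.
  move=> [t [At ti ta]] [t' [A't' t'i t'a]]; move: Az self; rewrite At A't'.
  move=> [i zi] self; have [zt'|nzt'] := pselect (z <<= t' i).
    by apply: self; exists i.
  have [//|t'z] := cut_le_comparable kX lcX (cut_le_trans zi (ti i)) (t'i i).
  exists (t' i); first by exists i; exact: cut_le_refl.
  rewrite metric_sym; apply: (eq_rank_close (cut_le_refl (x := t' i)) t'z zi) => //.
  by rewrite ta t'a.
move=> [s [t [st ti At sa ta]]] [s' [t' [st' ti' At' sa' ta']]].
move: Az self; rewrite At At' => -[sz zt] self.
have ze : z <<= e i := cut_le_trans zt ti.
have [s'z|ns'z] := pselect (s' <<= z); last first.
  have [//|zs'] := cut_le_comparable kX lcX (cut_le_trans st' ti') ze.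
  exists s'; first by split => //; exact: cut_le_refl.
  apply: (eq_rank_close sz zs' (cut_le_refl (x := s'))) => //.
  by rewrite sa sa'.
have [zt'|nzt'] := pselect (z <<= t'); first exact: self.
have [//|t'z] := cut_le_comparable kX lcX ze ti'.
exists t'; first by split => //; exact: cut_le_refl.
rewrite metric_sym; apply: (eq_rank_close (cut_le_refl (x := t')) t'z zt) => //.
by rewrite ta ta'.
Qed.

Lemma eq_code_iter_dist (c : star_code (size Q)) (A A' : subcontinua cX) :
  0 <= d -> has_code c (sval A) -> has_code c (sval A') -> iter_dist Cf n A A' <= d.
Proof.
move=> d0 cA cA'; apply: bigmax_le => // j _.
have half (B B' : subcontinua cX) : has_code c (sval B) -> has_code c (sval B') ->
    excess (sval (iter j Cf B)) (sval (iter j Cf B')) <= d.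
  move=> cB cB'; apply: ge_excess; first by have [] := svalP (iter j Cf B).
  rewrite !sval_iter_induced => _ [z Bz <-].
  have [z' B'z' zz'] := eq_code_close cB cB' (ltn_ord j) Bz.
  by apply: le_trans (ltW zz'); apply: dist_set_le; exists z'.
by rewrite mdist_subcontinuaE /hausdorff_dist ge_max !half.
Qed.

End same_code.

Lemma sep_le_expn (r : R) : (1 < k)%N -> 0 < r -> exists2 C, (0 < C)%N &
  forall n, (0 < n)%N -> (sep Cf n r <= ((C * n ^ k)%N%:R)%:E)%E.
Proof.
move=> k1 r0; have r20 : 0 < r / 2 by rewrite divr_gt0.
have [c cP] := exists_iter_partition r20.
exists (k.+1 * c.+1 ^ k)%N; first by rewrite muln_gt0 expn_gt0.
move=> n n0; have [Q sQ dQ] := cP n.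
apply: ge_ereal_sup => _ [E sepE <-]; rewrite lee_fin ler_nat.
have [code codeP] := choice (fun A : subcontinua cX => exists_code Q (svalP A)).
have inj_code : {in E &, injective code}.
  move=> A A' AE A'E AA'; apply/eqP; apply: contrapT => /negP neq.
  have := sepE A A' AE A'E neq; apply/negP; rewrite -ltNge.
  apply: (@le_lt_trans _ _ (r / 2)); last by rewrite ltr_pdivrMr// ltr_pMr// ltr1n.
  apply: (eq_code_iter_dist dQ (ltW r20) (codeP A)).
  by rewrite AA'.
have : (#|` E| <= #|star_code (size Q)|)%N.
  rewrite cardfE; apply: (@leq_card _ _ (fun A : E => code (val A))).
  by move=> A A' /inj_code AA'; apply/val_inj/AA'; exact: valP.
move=> /leq_trans; apply; rewrite card_sum card_ffun !card_prod !card_ord sQ.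
have le : ((n * c).+1 <= n * c.+1)%N by rewrite mulnS addnC -addn1 leq_add2l.
have le2 : ((n * c).+1 * (n * c).+1 <= (n * c).+1 ^ k)%N.
  by rewrite mulnn leq_pexp2l.
have lek : ((n * c).+1 ^ k <= (n * c.+1) ^ k)%N by rewrite leq_exp2r// ltnW.
rewrite -mulnA -expnMn (mulnC c.+1).
apply: (@leq_trans (k.+1 * (n * c).+1 ^ k)); last first.
  by rewrite leq_mul2l lek orbT.
by rewrite mulSn leq_add2l leq_mul2l le2 orbT.
Qed.

End star_dynamics.

(** * Polynomial growth of the number of separated points *)

Section growth.
Context {R : realType}.
Local Open Scope ereal_scope.

Lemma le_limn_esup (u v : (\bar R)^nat) : (\forall n \near \oo, u n <= v n) ->
  limn_esup u <= limn_esup v.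
Proof.
move=> uv; apply: le_ereal_inf_tmp => _ [V /= Voo <-].
apply: (@le_trans _ _ (ereal_sup (u @` (V `&` [set n | u n <= v n])))).
  apply: ereal_inf_lbound; exists (V `&` [set n | u n <= v n]) => //.
  exact: filterI.
apply: ge_ereal_sup => _ [n [Vn uvn] <-]; apply: le_trans uvn _.
by apply: ereal_sup_ubound; exists n.
Qed.

Lemma cvg_ln_ratio (a l : R) :
  ((a + l * ln n%:R) / ln n%:R)%:E @[n --> \oo] --> l%:E.
Proof.
apply: cvg_EFin; first by near=> n.
apply/cvgrPdist_le => /= d d0; near=> n.
have lnn : (`|a| / d <= ln n%:R)%R.
  near: n; have [N N_gt] : exists N : nat, (expR (`|a| / d) < N%:R)%R.
    exists (Num.truncn (expR (`|a| / d))).+1; exact: truncnS_gt.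
  exists N => // n /= Nn; rewrite -[leLHS]expRK ler_ln ?posrE ?expR_gt0//.
    by rewrite (le_trans (ltW N_gt))// ler_nat.
  by rewrite (lt_le_trans (expR_gt0 _) (le_trans (ltW N_gt) _))// ler_nat.
have ln0 : (0 < ln (n%:R : R))%R.
  by rewrite ln_gt0// ltr1n; near: n; exists 2%N.
rewrite mulrDl mulfK ?gt_eqF// opprD addrCA subrr addr0 normrN normrM normfV.
by rewrite (gtr0_norm ln0) ler_pdivrMr// mulrC -ler_pdivrMr.
Unshelve. all: by end_near. Qed.

(** The lower bound on s n is used with N = n %/ m, which is at least n / (2 m). *)
Lemma log_growth (s : (\bar R)^nat) (k m C : nat) : (0 < m)%N -> (0 < C)%N ->
  (forall n, (0 < n)%N -> s n <= ((C * n ^ k)%N%:R)%:E) ->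
  (forall N n, (m * N <= n)%N -> ((N ^ k)%N%:R)%:E <= s n) ->
  limn_esup (fun n => lne (s n) / (ln n%:R)%:E) = (k%:R)%:E.
Proof.
move=> m0 C0 s_le s_ge.
have ln0 n : (1 < n)%N -> (0 < ln (n%:R : R))%R by move=> n1; rewrite ln_gt0// ltr1n.
have s_ge0 n : 0 <= s n.
  by apply: le_trans (s_ge 0%N n _); rewrite ?muln0// lee_fin.
have natln a : (0 < a)%N -> ln ((a ^ k)%N%:R : R) = (k%:R * ln a%:R)%R.
  by move=> a0; rewrite natrX lnXn ?ltr0n// mulr_natl.
apply/eqP; rewrite eq_le; apply/andP; split.
  have [_ <-] := cvg_limn_einf_sup (@cvg_ln_ratio (ln C%:R) k%:R).
  apply: le_limn_esup; near=> n.
  have n1 : (1 < n)%N by near: n; exists 2%N.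
  have n0 : (0 < n)%N by exact: ltnW.
  rewrite inver gt_eqF ?ln0// EFinM lee_pmul2r// ?lte_fin ?invr_gt0 ?ln0//.
  rewrite -natln// -lnM ?posrE ?ltr0n ?expn_gt0 ?n0// -natrM.
  have Cn : (0 < (C * n ^ k)%N%:R :> R)%R by rewrite ltr0n muln_gt0 C0 expn_gt0 n0.
  rewrite -lne_EFin// lee_lne ?in_itv/= ?leey ?andbT ?lee_fin ?(ltW Cn)//.
  exact: s_le.
have [_ <-] := cvg_limn_einf_sup (@cvg_ln_ratio (- (k%:R * ln (2 * m)%N%:R)) k%:R).
apply: le_limn_esup; near=> n.
have n1 : (1 < n)%N by near: n; exists 2%N.
have n0 : (0 < n)%N by exact: ltnW.
have mn : (m <= n)%N by near: n; exists m.
pose N := (n %/ m)%N.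
have N0 : (0 < N)%N by rewrite divn_gt0.
have nN : (n <= 2 * m * N)%N.
  apply: ltnW; apply: (@leq_trans (N.+1 * m)); first exact: ltn_ceil.
  by rewrite mulnAC leq_mul2r mul2n -addnn -addn1 leq_add2l N0 orbT.
rewrite inver gt_eqF ?ln0// EFinM lee_pmul2r// ?lte_fin ?invr_gt0 ?ln0//.
apply: (@le_trans _ _ (lne ((N ^ k)%N%:R)%:E)); last first.
  rewrite lee_lne ?in_itv/= ?leey ?andbT ?lee_fin//.
  by apply: s_ge; rewrite mulnC leq_trunc_div.
rewrite lne_EFin ?ltr0n ?expn_gt0 ?N0// natln// lee_fin addrC -mulrBr.
apply: ler_wpM2l => //; rewrite lerBlDl -lnM ?posrE ?ltr0n ?muln_gt0 ?m0//.
by rewrite -natrM ler_ln ?posrE ?ltr0n ?muln_gt0 ?m0 ?N0// ler_nat.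
Unshelve. all: by end_near. Qed.

End growth.

Theorem theorem3 (R : realType) (X : metricType R) (k : nat)
    (starX : star X k) (f : X -> X) (homf : homeomorphism f)
    (edgef : forall I : set X, edge I -> exists2 x : X, I x & wandering f x) :
  pol_entropy (induced_map (star_compact starX) (homeomorphism_continuous homf))
    = (k%:R)%:E.
Proof.
have cX := star_compact starX.
have [[[_ kX lcX _ _] finE] [b [branchE ordb]]] := starX.
have branchb : branch_point b by rewrite branchE.
have k2 : (2 < k)%N.
  rewrite ltnNge; apply: contra branchb => k2; rewrite (card_le_eql ordb).
  by rewrite card_le_II.
have k0 : (0 < k)%N by apply: leq_trans k2.
have [e [eb emax ecover edisj]] := exists_branch_ends cX kX lcX finE branchE k0 ordb.
have below_kX x := @below_connected _ _ cX kX lcX b finE branchE x.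
have ecomp i y : connected_component (~` [set b]) (e i) y -> cut_le b y (e i).
  exact: component_below.
have fb : f b = b.
  by have := branch_point_homeomorphism homf branchb; rewrite branchE.
have wand i : exists2 x, cut_le b x (e i) & wandering f x.
  apply: (edgef [set y | cut_le b y (e i)]); exists b, (e i); split.
  - by left.
  - by right; exact: cut_maximal_end_point.
  - exact: below_arc.
have [m [d [m0 d0 sep_ge]]] := sep_ge_expn (star_compact starX) kX lcX eb emax ecover
  edisj below_kX homf fb wand.
apply: cvg_lim => //; apply: cvg_near_cst; near=> r.
have r0 : 0 < r by [].
have [C C0 sep_le] := sep_le_expn (star_compact starX) kX lcX ecover ecomp
  below_kX homf fb (ltnW k2) r0.
apply: (log_growth m0 C0) => [n n0|N n mN]; first exact: sep_le.
by apply: sep_ge => //; near: r; exact: nbhs_right_le.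
Unshelve. all: by end_near. Qed.
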